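(* Let $x_1,x_2,y_1,y_2,v_1,v_2$ be indeterminates, and for $n\ge0$ define $$B_n(x_1,x_2,y_1,y_2,v_1,v_2)=\sum_{\pi\in\Pi_n}x_1^{m_1(\pi)}x_2^{m_{\ge2}(\pi)}y_1^{\mathrm{erecin}(\pi)}y_2^{\mathrm{erecop}(\pi)}v_1^{\mathrm{nerecin}(\pi)}v_2^{\mathrm{nerecop}(\pi)}.$$ Then $$\sum_{n=0}^\infty B_n(x_1,x_2,y_1,y_2,v_1,v_2)\,t^n=\cfrac{1}{1-\gamma_0 t-\cfrac{\beta_1t^2}{1-\gamma_1t-\cfrac{\beta_2t^2}{1-\gamma_2 t-\cdots}}}$$ with coefficients $$\gamma_0=x_1,\qquad\gamma_n=x_1+y_1+(n-1)v_1\quad(n\ge1),\qquad \beta_n=x_2\,[y_2+(n-1)v_2]\quad(n\ge1).$$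
   Context: $\Pi_n$ is the set of partitions of $[n]=\{1,\dots,n\}$ into nonempty blocks. Continued fractions are identities of formal power series in $t$. For $\pi\in\Pi_n$, an element $i\in[n]$ is an opener if it is the smallest element of a block of size $\ge2$; a closer if it is the largest element of a block of size $\ge2$; an insider if it is a non-opener non-closer element of a block of size $\ge3$; a singleton if it is the sole element of a block of size 1. For $i\in[n]$ let $\sigma'(i)$ be the next-larger element after $i$ in its block if $i$ is not the largest element of its block, and $\sigma'(i)=0$ otherwise; $i$ is an exclusive record of $\pi$ if $\sigma'(i)\ne0$ and $\sigma'(j)<\sigma'(i)$ for all $j<i$ (an exclusive record is always an opener or an insider). $m_1(\pi)$ is the number of singletons, $m_{\ge2}(\pi)$ the number of blocks of size $\ge2$, $\mathrm{erecin}(\pi)$ [resp. $\mathrm{erecop}(\pi)$] the number of insiders [resp. openers] that are exclusive records, and $\mathrm{nerecin}(\pi)$ [resp. $\mathrm{nerecop}(\pi)$] the number of insiders [resp. openers] that are not exclusive records. *)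

(* Defs.v *)
From mathcomp Require Import all_boot all_order all_algebra.

Set Implicit Arguments.
Unset Strict Implicit.
Unset Printing Implicit Defensive.

Import GRing.Theory.

Local Open Scope ring_scope.

(* A formal power series in t is its sequence of coefficients. *)
Definition fps (R : Type) := nat -> R.

Section PowerSeries.
Variable R : comNzRingType.
Implicit Types (f g h : fps R) (c : R).

Definition fps_const c : fps R := fun n => if n == 0%N then c else 0.
Definition fps_t : fps R := fun n => if n == 1%N then 1 else 0.
Definition fps_sub f g : fps R := fun n => f n - g n.
Definition fps_mul f g : fps R := fun n => \sum_(i < n.+1) f i * g (n - i)%N.
Definition fps_exp f k : fps R := iter k (fps_mul f) (fps_const 1).

(* 1 / f = \sum_k (1 - f)^k, for f with constant term 1; see fps_mulV below. *)
Definition fps_inv f : fps R :=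
  fun n => \sum_(k < n.+1) fps_exp (fps_sub (fps_const 1) f) k n.

Lemma fps_mul0 f g : fps_mul f g 0%N = f 0%N * g 0%N.
Proof. by rewrite /fps_mul big_ord_recl big_ord0 addr0. Qed.

Lemma fps_exp_lt f k n : f 0%N = 0 -> (n < k)%N -> fps_exp f k n = 0.
Proof.
move=> f0; elim: k n => [//|k IHk] n; rewrite ltnS => le_nk.
rewrite /fps_exp /= -/(fps_exp f k) /fps_mul big_ord_recl f0 mul0r add0r.
rewrite big1 // => i _; rewrite IHk ?mulr0 // lift0.
by case: n i le_nk => [[]//|n] i le_nk; rewrite subSS (leq_ltn_trans (leq_subr _ _)).
Qed.

Lemma fps_mul1 f n : fps_mul (fps_const 1) f n = f n.
Proof.
rewrite /fps_mul big_ord_recl mul1r subn0 big1 ?addr0 // => i _.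
by rewrite mul0r.
Qed.

Lemma fps_mulV f : f 0%N = 1 -> fps_mul f (fps_inv f) =1 fps_const 1.
Proof.
move=> f0 n; set h := fps_sub (fps_const 1) f.
have h0 : h 0%N = 0 by rewrite /h /fps_sub f0 subrr.
have -> : fps_mul f (fps_inv f) n
    = \sum_(k < n.+1) (fps_exp h k n - fps_exp h k.+1 n).
  transitivity (\sum_(i < n.+1) \sum_(k < n.+1) f i * fps_exp h k (n - i)%N).
    apply: eq_bigr => i _; rewrite -mulr_sumr; congr (_ * _).
    have le_n : ((n - i).+1 <= n.+1)%N by rewrite ltnS leq_subr.
    rewrite /fps_inv -/h (big_ord_widen _ (fun k => fps_exp h k (n - i)%N) le_n).
    rewrite big_mkcond; apply: eq_bigr => k _ /=.
    by case: ltnP => // lt; rewrite fps_exp_lt.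
  rewrite exchange_big; apply: eq_bigr => k _ /=.
    rewrite -{1}[fps_exp h k n]fps_mul1 -sumrB; apply: eq_bigr => i _.
    by rewrite -/(fps_exp h k) -mulrBl /h /fps_sub opprB addrC subrK.
rewrite -(big_mkord xpredT (fun k => fps_exp h k n - fps_exp h k.+1 n)).
under eq_bigr do rewrite -opprB.
by rewrite sumrN telescope_sumr // opprB (fps_exp_lt h0 (ltnSn n)) subr0.
Qed.

(* The [K]-th convergent of the tail of the J-fraction starting at level [k]:
   1/(1 - gamma_k t - beta_(k+1) t^2/( ... - beta_(k+K) t^2/(1 - gamma_(k+K) t))). *)
Fixpoint jfrac_conv (gamma beta : nat -> R) (K k : nat) : fps R :=
  let d := fps_sub (fps_const 1) (fps_mul (fps_const (gamma k)) fps_t) in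
  if K is K'.+1 then
    fps_inv (fps_sub d
      (fps_mul (fps_mul (fps_const (beta k.+1)) (fps_exp fps_t 2))
               (jfrac_conv gamma beta K' k.+1)))
  else fps_inv d.

(* [f] is the limit of the convergents for coefficientwise (t-adic) convergence;
   beta 0 plays no role. *)
Definition is_jfrac (gamma beta : nat -> R) f : Prop :=
  forall n, exists K0, forall K, (K0 <= K)%N -> jfrac_conv gamma beta K 0 n = f n.

End PowerSeries.

(* The element i of [n] is represented by i - 1 : 'I_n. *)
Section SetPartitionStatistics.
Variable n : nat.
Implicit Types (P : {set {set 'I_n}}) (i : 'I_n).

Definition smallest_in_block P i := [forall j in pblock P i, i <= j]%N.
Definition largest_in_block P i := [forall j in pblock P i, j <= i]%N.

Definition opener P i := (2 <= #|pblock P i|)%N && smallest_in_block P i.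
Definition closer P i := (2 <= #|pblock P i|)%N && largest_in_block P i.
Definition insider P i :=
  [&& (3 <= #|pblock P i|)%N, ~~ opener P i & ~~ closer P i].
Definition singleton P i := #|pblock P i| == 1%N.

(* Values are in {1, ..., n}, hence the successor, or 0 if i is the largest
   element of its block. *)
Definition sigma' P i : nat :=
  if [pick j in pblock P i | (i < j)%N &
        [forall k in pblock P i, (i < k) ==> (j <= k)]%N] is Some j
  then j.+1 else 0%N.

Definition erec P i :=
  (sigma' P i != 0%N) &&
  [forall j : 'I_n, (j < i) ==> (sigma' P j < sigma' P i)]%N.

Definition m1 P := #|[set i | singleton P i]|.
Definition m_ge2 P := #|[set A in P | 2 <= #|A|]|%N.
Definition erecin P := #|[set i | insider P i & erec P i]|.
Definition erecop P := #|[set i | opener P i & erec P i]|.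
Definition nerecin P := #|[set i | insider P i & ~~ erec P i]|.
Definition nerecop P := #|[set i | opener P i & ~~ erec P i]|.

End SetPartitionStatistics.

Definition B (R : comNzRingType) (x1 x2 y1 y2 v1 v2 : R) (n : nat) : R :=
  \sum_(P : {set {set 'I_n}} | partition P [set: 'I_n])
    x1 ^+ m1 P * x2 ^+ m_ge2 P * y1 ^+ erecin P * y2 ^+ erecop P
    * v1 ^+ nerecin P * v2 ^+ nerecop P.

(* Main.v *)
Require Import Defs.
From mathcomp Require Import all_boot all_order all_algebra ring.
From mathcomp Require Import mpoly.
From Stdlib Require Import FunctionalExtensionality.

(** Both sides of the identity count the same weighted lattice paths.

    The J-fraction side is the fundamental theorem of Flajolet: the fraction is
    the generating function of the Motzkin paths of length n from height 0 to
    height 0, where a level step at height k weighs gamma_k, a fall from height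
    k weighs beta_k and a rise weighs 1 ([motzkin], [is_jfrac_motzkin]).  The
    series of the paths that start at height k, divided by the k-th tail of the
    fraction, is beta_k t times the series of those that start at height k - 1;
    clearing the denominators of the tails turns this into the recursion that
    removes the first step of a path ([jfrac_from_rec]).  The K-th convergent
    only sees paths of height at most K, so its coefficients are exact in
    degrees below K.

    For the partition side, draw the arc from i to the next larger element of
    its block.  A set partition is the same thing as an increasing injective
    partial map i |-> next element ([next_blocks], [blocks_next]).  Now read the
    elements from n down to 1 and record at each stage the number k of pending
    elements, those that already appeared, are the target of an arc, and whose
    arc source has not appeared yet.  The next element read is
    - a singleton: k is unchanged, weight x1;
    - a closer: it becomes pending, so k increases by 1, weight 1;
    - an opener: it is the source of an arc to one of the k pending elements, so
      k decreases by 1;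
    - an insider: it is the source of such an arc and becomes pending itself, so
      k is unchanged.
    The smaller elements will be joined to the other pending elements and to
    elements that appear later, which are smaller.  Hence an opener or insider is
    an exclusive record exactly when it picks the largest of the k pending
    elements: one choice out of k gets y and the k - 1 others get v.  In total an
    opener contributes x2 (y2 + (k - 1) v2) = beta_k, and the steps that keep k
    contribute x1 + [k > 0] (y1 + (k - 1) v1) = gamma_k
    ([pending_sum_rec], [pending_sum_motzkin]).  The number of pending elements
    is 0 at both ends, so B_n is the sum over the same Motzkin paths
    ([B_motzkin]). *)

Set Implicit Arguments.
Unset Strict Implicit.
Unset Printing Implicit Defensive.

Import GRing.Theory.

Local Open Scope ring_scope.

(** * Algebra of formal power series *)

Section PowerSeriesAlgebra.
Variable R : comNzRingType.
Implicit Types (f g h : fps R) (c : R).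

(** Truncating to polynomials lets the ring laws of series be read off those of
    polynomials. *)
Lemma coef_mul_trunc N f g n : (n <= N)%N ->
  ((\poly_(i < N.+1) f i) * (\poly_(i < N.+1) g i))`_n = fps_mul f g n.
Proof.
move=> le_nN; rewrite coefM; apply: eq_bigr => i _; rewrite !coef_poly.
have lt_iN : (i < N.+1)%N by rewrite (leq_trans (ltn_ord i)).
by rewrite lt_iN ltnS (leq_trans (leq_subr _ _)).
Qed.

Lemma fps_mulC f g : fps_mul f g = fps_mul g f.
Proof.
apply: functional_extensionality => n.
by rewrite -!(coef_mul_trunc _ _ (leqnn n)) mulrC.
Qed.

Lemma fps_mulA f g h : fps_mul f (fps_mul g h) = fps_mul (fps_mul f g) h.
Proof.
apply: functional_extensionality => n.
pose p (u : fps R) := \poly_(i < n.+1) u i.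
transitivity ((p f * (p g * p h))`_n); last rewrite mulrA.
  rewrite coefM; apply: eq_bigr => i _; rewrite coef_poly ltn_ord.
  by rewrite coef_mul_trunc ?leq_subr.
rewrite coefM; apply: eq_bigr => i _; rewrite coef_poly ltnS leq_subr.
by rewrite coef_mul_trunc // -ltnS.
Qed.

Lemma fps_mul_const c f n : fps_mul (fps_const c) f n = c * f n.
Proof.
rewrite /fps_mul big_ord_recl subn0 big1 ?addr0 // => i _.
by rewrite mul0r.
Qed.

Lemma fps_mul_t0 f : fps_mul (@fps_t R) f 0%N = 0.
Proof. by rewrite fps_mul0 mul0r. Qed.

Lemma fps_mul_tS f n : fps_mul (@fps_t R) f n.+1 = f n.
Proof.
rewrite /fps_mul !big_ord_recl /= mul0r add0r mul1r subSS subn0.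
by rewrite big1 ?addr0 // => i _; rewrite mul0r.
Qed.

Lemma fps_mulBl f g h n :
  fps_mul (fps_sub f g) h n = fps_mul f h n - fps_mul g h n.
Proof. by rewrite -sumrB; apply: eq_bigr => i _; rewrite mulrBl. Qed.

Lemma fps_exp_t2 : fps_exp (@fps_t R) 2 = fps_mul (@fps_t R) (@fps_t R).
Proof.
apply: functional_extensionality => n.
by rewrite /fps_exp /= fps_mulA fps_mulC fps_mul1.
Qed.

End PowerSeriesAlgebra.

(** * Motzkin paths and J-fractions *)

Section MotzkinPaths.
Variables (R : comNzRingType) (gamma beta : nat -> R).

(** Paths of [n] steps from height [k] to height 0, decomposed by the first step. *)
Fixpoint motzkin n k : R :=
  if n is n'.+1 then
    gamma k * motzkin n' k + motzkin n' k.+1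
    + (if k is k'.+1 then beta k * motzkin n' k' else 0)
  else (k == 0%N)%:R.

(** The series whose inverse is [jfrac_conv gamma beta K k]. *)
Definition jfrac_denom K k : fps R :=
  let d := fps_sub (fps_const 1) (fps_mul (fps_const (gamma k)) (@fps_t R)) in
  if K is K'.+1 then
    fps_sub d (fps_mul (fps_mul (fps_const (beta k.+1)) (fps_exp (@fps_t R) 2))
                       (jfrac_conv gamma beta K' k.+1))
  else d.

Lemma jfrac_denomS K k :
  jfrac_denom K.+1 k =
    fps_sub (jfrac_denom 0 k)
      (fps_mul (fps_mul (fps_const (beta k.+1)) (fps_exp (@fps_t R) 2))
               (jfrac_conv gamma beta K k.+1)).
Proof. by []. Qed.

Lemma jfrac_denomK K k g :
  fps_mul (jfrac_denom K k) (fps_mul (jfrac_conv gamma beta K k) g) = g.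
Proof.
rewrite fps_mulA; apply: functional_extensionality => n.
rewrite -[RHS]fps_mul1; apply: eq_bigr => i _; congr (_ * _).
have -> : jfrac_conv gamma beta K k = fps_inv (jfrac_denom K k) by case: K.
apply: fps_mulV; rewrite /jfrac_denom.
case: K => [|K]; rewrite /fps_sub !fps_mul0 /= ?fps_exp_t2 ?fps_mul_t0.
  by rewrite mulr0 subr0.
by rewrite !(mulr0, mul0r) !subr0.
Qed.

(** Generating function of the paths from height [k] to height 0 that stay
    at height at most [K]: such a path first stays at height at least [k], which
    the tail of the fraction at level [k] counts, and then falls to [k - 1]. *)
Fixpoint jfrac_from K k : fps R :=
  fps_mul (jfrac_conv gamma beta (K - k) k)
    (if k is k'.+1
     then fps_mul (fps_const (beta k)) (fps_mul (@fps_t R) (jfrac_from K k'))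
     else fps_const 1).

Definition jfrac_from_numer K k : fps R :=
  if k is k'.+1
  then fps_mul (fps_const (beta k)) (fps_mul (@fps_t R) (jfrac_from K k'))
  else fps_const 1.

Lemma jfrac_fromE K k :
  jfrac_from K k
  = fps_mul (jfrac_conv gamma beta (K - k) k) (jfrac_from_numer K k).
Proof. by case: k. Qed.

(** The tail at level [k] is the inverse of
    D = 1 - gamma_k t - beta_(k+1) t^2 J, with J the tail at level [k + 1].
    Multiplying [jfrac_from K k] by D leaves its numerator, and
    beta_(k+1) t^2 J times [jfrac_from K k] is t times [jfrac_from K k.+1]. *)
Lemma jfrac_from_rec K k n : (k < K)%N ->
  jfrac_from K k n =
    jfrac_from_numer K k n
    + gamma k * fps_mul (@fps_t R) (jfrac_from K k) n
    + fps_mul (@fps_t R) (jfrac_from K k.+1) n.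
Proof.
move=> lt_kK; rewrite [jfrac_from K k.+1]jfrac_fromE /=.
have <- := jfrac_denomK (K - k) k (jfrac_from_numer K k).
rewrite -jfrac_fromE -{1}(subnSK lt_kK) jfrac_denomS fps_exp_t2 !fps_mulBl fps_mul1.
rewrite -!fps_mulA !fps_mul_const.
set J := jfrac_conv _ _ _ _; set F := jfrac_from K k.
suff -> : fps_mul (@fps_t R) (fps_mul J (fps_mul (fps_const (beta k.+1))
            (fps_mul (@fps_t R) F)))
          = fps_mul (fps_const (beta k.+1))
              (fps_mul (@fps_t R) (fps_mul (@fps_t R) (fps_mul J F))).
  by rewrite fps_mul_const; ring.
rewrite [fps_mul J _]fps_mulA [fps_mul J (fps_const _)]fps_mulC -fps_mulA.
rewrite fps_mulA [fps_mul _ (fps_const _)]fps_mulC -fps_mulA.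
by rewrite [fps_mul J (fps_mul _ F)]fps_mulA [fps_mul J _]fps_mulC -fps_mulA.
Qed.

(** A path of [n] steps from height [k] never exceeds height [k + n], so the
    bound [K] does not constrain it. *)
Lemma jfrac_from_motzkin K n k : (k + n < K)%N ->
  jfrac_from K k n = motzkin n k.
Proof.
elim: n k => [|n IHn] k; rewrite ?addn0 ?addnS => lt_K.
  rewrite jfrac_from_rec // !fps_mul_t0 mulr0 !addr0.
  by case: k {lt_K} => [|k] //; rewrite /= fps_mul_const fps_mul_t0 mulr0.
have lt_kn_K : (k + n < K)%N := ltnW lt_K.
rewrite jfrac_from_rec ?(leq_ltn_trans (leq_addr n k)) // !fps_mul_tS.
rewrite !IHn ?addSn //= -addrA addrC; congr (_ + _).
case: k lt_K lt_kn_K => [|k] lt_K lt_kn_K //; rewrite /jfrac_from_numer.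
by rewrite fps_mul_const fps_mul_tS IHn // (leq_ltn_trans _ lt_kn_K) ?leq_add2r.
Qed.

Lemma is_jfrac_motzkin : is_jfrac gamma beta (motzkin^~ 0%N).
Proof.
move=> n; exists n.+1 => K lt_nK; rewrite -(@jfrac_from_motzkin K n 0) //=.
by rewrite subn0 fps_mulC; apply/esym/fps_mul1.
Qed.

End MotzkinPaths.

(** * Arc diagrams with pending targets *)

Section ArcDiagrams.
Variable N : nat.
Implicit Types (f g : {ffun 'I_N -> option 'I_N}) (E F : {set 'I_N}).
Implicit Types (i j p e : 'I_N) (v : option 'I_N).

(** Only sources below [i] are inspected, so that the weight of [i] depends on
    nothing but the arcs leaving elements at most [i]; arcs go upwards, hence no
    source is missed. *)
Definition receives f i := [exists j : 'I_N, (j < i)%N && (f j == Some i)].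

Definition arc_record f i e :=
  [forall j : 'I_N, (j < i)%N ==> if f j is Some e' then (e' < e)%N else true].

(** The arcs that remain to be drawn when the elements from [m] on have been
    read and [E] is the set of pending elements: arcs increase, have
    distinct targets, leave elements below [m], end below [m] or in [E], and
    reach all of [E]. *)
Definition pending m E f :=
  [&& [forall i, if f i is Some j
                 then [&& i < m, i < j & (j < m) || (j \in E)]%N else true],
      [forall i, forall i', (f i == f i') && (f i != None) ==> (i == i')]
    & [forall e in E, exists i, f i == Some e]].

Lemma pendingP m E f :
  reflect [/\ forall i j, f i = Some j ->
                [&& i < m, i < j & (j < m) || (j \in E)]%N,
              forall i i' j, f i = Some j -> f i' = Some j -> i = i'
            & forall e, e \in E -> exists i, f i = Some e]
          (pending m E f).
Proof.
apply: (iffP and3P) => -[H1 H2 H3]; split.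
- by move=> i j fi; have /forallP/(_ i) := H1; rewrite fi.
- move=> i i' j fi fi'; have /forallP/(_ i)/forallP/(_ i') := H2.
  by rewrite fi fi' eqxx => /eqP.
- move=> e eE; have /forall_inP/(_ e eE)/existsP[i /eqP fi] := H3.
  by exists i.
- by apply/forallP => i; case fi: (f i) => [j|] //; apply: H1.
- apply/forallP => i; apply/forallP => i'; apply/implyP => /andP[/eqP ff'].
  by case fi: (f i) ff' => [j|] // /esym fi' _; apply/eqP/(H2 _ _ j).
- by apply/forall_inP => e /H3[i fi]; apply/existsP; exists i; rewrite fi.
Qed.

Definition set_arc f p v : {ffun 'I_N -> option 'I_N} :=
  [ffun i => if i == p then v else f i].

Definition consume E v := if v is Some e then E :\ e else E.

(** [v] is the target chosen by the element just read, [None] if it is the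
    source of no arc. *)
Definition is_available E v := if v is Some e then e \in E else true.

(** When [p] is the last element read, [p] is in the pending set exactly if
    the elements below it have to supply the source of an arc to it. *)
Lemma receives_pending p F f : pending p F f -> receives f p = (p \in F).
Proof.
case/pendingP=> H1 _ H3; apply/existsP/idP => [[j /andP[lt_jp /eqP fj]]|pF].
  by have /and3P[_ _] := H1 _ _ fj; rewrite ltnn.
have [i fi] := H3 p pF; exists i; rewrite fi eqxx andbT.
by case/and3P: (H1 _ _ fi).
Qed.

(** Reading [p] amounts to two independent decisions: the target [v] of [p], none
    or one of the pending elements, which is then used up, and whether [p]
    itself becomes pending. *)
Lemma pending_set_arc p E v f : (forall e, e \in E -> (p < e)%N) ->
  pending p.+1 E (set_arc f p v) && (f p == None)
  = is_available E v && (pending p (consume E v) f || pending p (p |: consume E v) f).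
Proof.
move=> ltE; set h := set_arc f p v.
have hp : h p = v by rewrite ffunE eqxx.
have hN i : i != p -> h i = f i by rewrite ffunE => /negPf->.
have sub e : e \in consume E v -> (e \in E) /\ v <> Some e.
  case: v {h hp hN} => [e'|] //=; rewrite !inE => /andP[ne ->]; split=> //.
  by case=> ee; rewrite ee eqxx in ne.
have subC e : e \in E -> v <> Some e -> e \in consume E v.
  case: v {h hp hN sub} => [e'|] //= eE ne; rewrite !inE eE andbT.
  by apply/eqP => ee; case: ne; rewrite ee.
apply/andP/andP => [[/pendingP[H1 H2 H3] /eqP fp]|[v_free pend]].
  have neq i j : f i = Some j -> i != p.
    by move=> fi; apply/eqP => ip; rewrite ip fp in fi.
  have vE : is_available E v.
    case Dv: v hp => [e|] // hp; have /and3P[_ lt_pe] := H1 _ _ hp.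
    by rewrite ltnS leqNgt lt_pe.
  split=> //.
  (* Both alternatives of the conclusion at once: [F] is [consume E v],
     with [p] added exactly if [p] is the target of an arc. *)
  have key F : (forall e, e \in F -> e \in consume E v \/ e = p /\ receives f p) ->
      {subset consume E v <= F} -> (receives f p -> p \in F) -> pending p F f.
    move=> subF Fsub pF; apply/pendingP; split.
    - move=> i j fi; have ne := neq _ _ fi; have hi := hN i ne.
      have /and3P[] := H1 i j (etrans hi fi).
      rewrite ltnS leq_eqVlt => /orP[/eqP/val_inj ip|lt_ip lt_ij].
        by rewrite ip eqxx in ne.
      rewrite lt_ip lt_ij /= ltnS leq_eqVlt -orbA => /or3P[/eqP jp|->//|jE].
        rewrite (val_inj jp) pF ?orbT //; apply/existsP; exists i.
        by rewrite lt_ip fi (val_inj jp) eqxx.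
      rewrite Fsub ?orbT //; apply: subC => // vj.
      by rewrite (H2 p i j) ?eqxx ?hi // ?hp in ne.
    - by move=> i i' j fi fi'; apply: (H2 i i' j); rewrite hN ?(neq _ j).
    - move=> e /subF[/sub[eE ne]|[-> /existsP[j /andP[_ /eqP fj]]]]; last by exists j.
      have [i hi] := H3 e eE; exists i; rewrite -hN //; apply/eqP => ip.
      by apply: ne; rewrite -hp -ip.
  case rp: (receives f p).
    apply/orP; right; apply: key => [e|e|_].
    - by case/setU1P=> ?; [right|left].
    - exact: setU1r.
    - exact: setU11.
  by apply/orP; left; apply: key => [e| |]; [left| |rewrite rp].
have {pend} [F [subF Fsub /pendingP[H1 H2 H3]]] : exists F,
    [/\ forall e, e \in F -> e \in consume E v \/ e = p,
        {subset consume E v <= F} & pending p F f].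
  case/orP: pend => pend; [exists (consume E v)|exists (p |: consume E v)].
    by split=> // e; left.
  by split=> // e; [case/setU1P; [right|left]|apply: setU1r].
have fp : f p = None.
  by case fp: (f p) => [j|] //; have := H1 _ _ fp; rewrite ltnn.
have fv i : f i <> v \/ v = None.
  case Dv: v => [e|]; [left=> fi|by right].
  have pe : (p < e)%N by apply: ltE; move: v_free; rewrite Dv.
  have /and3P[_ _] := H1 _ _ fi; rewrite ltnNge (ltnW pe) /=.
  by case/subF=> [/sub[]|ep]; [rewrite Dv|rewrite ep ltnn in pe].
split; last by rewrite fp.
apply/pendingP; split.
- move=> i j; have [->|ne] := eqVneq i p.
    rewrite hp => Dv; have jE : j \in E by rewrite Dv in v_free.
    by rewrite ltnS leqnn ltE // jE orbT.
  rewrite hN // => /H1/and3P[lt_ip -> jF]; rewrite ltnS (ltnW lt_ip) /=.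
  case/orP: jF => [lt_jp|/subF[/sub[->]|->]]; rewrite ?orbT ?ltnSn //.
  by rewrite ltnS (ltnW lt_jp).
- move=> i i' j; have [->|ne] := eqVneq i p; have [->|ne'] := eqVneq i' p;
    rewrite ?hp ?hN //.
  + by move=> vj fj; case: (fv i'); rewrite vj ?fj.
  + by move=> fj vj; case: (fv i); rewrite vj ?fj.
  + exact: H2.
- move=> e eE; have [Dv|/eqP ne] := eqVneq v (Some e); first by exists p; rewrite hp.
  have [i fi] := H3 e (Fsub e (subC e eE ne)); exists i; rewrite hN //.
  by apply/eqP => ip; rewrite ip fp in fi.
Qed.

End ArcDiagrams.

(** * Weighted sums over arc diagrams *)

Section ArcSums.
Variables (R : comNzRingType) (x1 x2 y1 y2 v1 v2 : R) (N : nat).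
Implicit Types (f g : {ffun 'I_N -> option 'I_N}) (E F : {set 'I_N}).
Implicit Types (i j p e : 'I_N) (v : option 'I_N).

Definition arc_weight f i : R :=
  if f i is Some e then
    if receives f i then (if arc_record f i e then y1 else v1)
    else x2 * (if arc_record f i e then y2 else v2)
  else if receives f i then 1 else x1.

Definition pending_sum m E : R :=
  \sum_(f | pending m E f) \prod_(i < N | (i < m)%N) arc_weight f i.

Lemma arc_weight_local f g i : (forall j, (j <= i)%N -> f j = g j) ->
  arc_weight f i = arc_weight g i.
Proof.
move=> fg; rewrite /arc_weight fg //.
have -> : receives f i = receives g i.
  by apply: eq_existsb => j; case: ltnP => //= /ltnW/fg->.
case: (g i) => // e; suff -> : arc_record f i e = arc_record g i e by [].
by apply: eq_forallb => j; case: ltnP => //= /ltnW/fg->.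
Qed.

(** Weight of the last element read when the pending set was [E], its target
    is [v], and [b] tells whether it becomes pending; a record is the choice of
    the largest pending element. *)
Definition top_weight E v (b : bool) : R :=
  if v is Some e then
    let r := [forall e' in E, e' <= e]%N in
    if b then (if r then y1 else v1) else x2 * (if r then y2 else v2)
  else if b then 1 else x1.

(** The elements below [p] are joined to the pending elements other than [v] and
    to elements at most [p]; the latter are smaller than [v], so [p] is a record
    exactly if [v] is the largest element of [E]. *)
Lemma arc_weight_top p E F f v : (forall e, e \in E -> (p < e)%N) ->
    is_available E v -> consume E v \subset F -> F \subset p |: consume E v ->
    pending p F f ->
  arc_weight (set_arc f p v) p = top_weight E v (p \in F).
Proof.
move=> ltE v_free subF Fsub pend; have /pendingP[H1 _ H3] := pend.
have set_lt j : (j < p)%N -> set_arc f p v j = f j.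
  by rewrite ffunE; case: eqP => // ->; rewrite ltnn.
have recE : receives (set_arc f p v) p = (p \in F).
  rewrite -(receives_pending pend); apply: eq_existsb => j.
  by case: ltnP => //= /set_lt->.
rewrite /arc_weight recE {1}/set_arc ffunE eqxx.
case: v v_free subF Fsub recE set_lt => [e|] //= eE subF Fsub _ set_lt.
suff -> : arc_record (set_arc f p (Some e)) p e = [forall e' in E, e' <= e]%N by [].
apply/forallP/forall_inP => [rec e' e'E|le_e j].
  have [-> //|ne] := eqVneq e' e.
  have /H3[j fj] : e' \in F by apply: (subsetP subF); rewrite !inE ne.
  have /and3P[lt_jp _ _] := H1 _ _ fj.
  by have := rec j; rewrite lt_jp set_lt // fj; apply: ltnW.
apply/implyP => lt_jp; rewrite set_lt //; case fj: (f j) => [e'|] //.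
have /and3P[_ _ /orP[lt_e'p|/(subsetP Fsub)]] := H1 _ _ fj.
  exact: ltn_trans lt_e'p (ltE e eE).
case/setU1P => [->|]; first exact: ltE.
by rewrite !inE ltn_neqAle => /andP[ne /le_e->]; rewrite andbT.
Qed.

(** Sum over the two decisions made by [p]: its target [v], and whether it
    becomes pending. *)
Lemma pending_sum_rec p E : (forall e, e \in E -> (p < e)%N) ->
  pending_sum p.+1 E =
    \sum_(v | is_available E v)
       (top_weight E v false * pending_sum p (consume E v)
        + top_weight E v true * pending_sum p (p |: consume E v)).
Proof.
move=> ltE; rewrite /pending_sum (partition_big (fun f => f p) xpredT) //=.
rewrite [RHS]big_mkcond; apply: eq_bigr => v _.
rewrite (reindex_onto (fun g => set_arc g p v) (fun f => set_arc f p None)) /=;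
  last first.
  move=> f /andP[_ /eqP fp]; apply/ffunP => i; rewrite !ffunE.
  by case: eqP => // ->.
have set_set g : (set_arc (set_arc g p v) p None == g) = (g p == None).
  apply/eqP/eqP => [<-|gp]; first by rewrite ffunE eqxx.
  by apply/ffunP => i; rewrite !ffunE; case: eqP => // ->.
under eq_bigl => g do
  rewrite set_set [set_arc g p v p]ffunE !eqxx andbT pending_set_arc //.
case: ifP => v_free /=; last by rewrite big_pred0.
have pNE : p \notin consume E v.
  apply/negP => pE; suff /ltE : p \in E by rewrite ltnn.
  by case: (v) pE => [e|] //=; rewrite !inE => /andP[].
have prod_set F g : consume E v \subset F -> F \subset p |: consume E v ->
    pending p F g ->
  \prod_(i < N | (i < p.+1)%N) arc_weight (set_arc g p v) i
  = top_weight E v (p \in F) * \prod_(i < N | (i < p)%N) arc_weight g i.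
  move=> subF Fsub pend; rewrite (bigD1 p) //= (arc_weight_top ltE _ _ _ pend) //.
  congr (_ * _); apply: eq_big => [i|i /andP[lt_ip ne]].
    by rewrite ltnS [RHS]ltn_neqAle andbC.
  apply: arc_weight_local => j le_ji; rewrite ffunE; case: eqP => // jp.
  by case/eqP: ne; apply/val_inj/eqP; rewrite eqn_leq -ltnS lt_ip -jp.
rewrite (bigID (fun g => receives g p)) /= addrC !mulr_sumr.
congr (_ + _); apply: eq_big => [g|g /andP[/orP[] pend]].
- apply/andP/idP => [[/orP[//|pend]]|pend].
    by rewrite (receives_pending pend) setU11.
  by rewrite pend (receives_pending pend).
- by rewrite (prod_set _ _ _ _ pend) ?subsetUr // (negPf pNE).
- by rewrite (receives_pending pend) setU11.
- apply/andP/idP => [[/orP[pend|//]]|pend].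
    by rewrite (receives_pending pend) (negPf pNE).
  by rewrite pend orbT (receives_pending pend) setU11.
- by rewrite (receives_pending pend) (negPf pNE).
- by rewrite (prod_set _ _ _ _ pend) ?subsetUr // setU11.
Qed.

(** Exactly one of the choices is the largest element. *)
Lemma sum_largest E (a b : R) e0 : e0 \in E ->
  \sum_(e in E) (if [forall e' in E, e' <= e]%N then a else b)
  = a + (#|E| - 1)%:R * b.
Proof.
move=> e0E; have [e eE max_e] := arg_maxnP (fun e => nat_of_ord e) e0E.
have {}eE : e \in E by exact: eE.
have {}max_e e' : e' \in E -> (e' <= e)%N by exact: max_e.
have maxE e' : e' \in E -> [forall e'' in E, e'' <= e']%N = (e' == e).
  move=> e'E; apply/forall_inP/eqP => [le|-> e'' /max_e //].
  by apply/val_inj/eqP; rewrite eqn_leq max_e // le.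
rewrite (bigD1 e) //= maxE // eqxx; congr (_ + _).
rewrite (eq_bigr (fun=> b)) => [|e' /andP[e'E /negPf ne]]; last by rewrite maxE // ne.
rewrite sumr_const mulr_natl; congr (_ *+ _).
rewrite (cardsD1 e E) eE addKn -sum1_card -[RHS]sum1_card.
by apply: eq_bigl => e'; rewrite !inE andbC.
Qed.

Definition gamma n : R := if n == 0%N then x1 else x1 + y1 + (n - 1)%:R * v1.
Definition beta n : R := x2 * (y2 + (n - 1)%:R * v2).

(** The sum depends on the pending elements through their number only:
    this number is the height of the path. *)
Lemma pending_sum_motzkin m E : (m <= N)%N -> (forall e, e \in E -> (m <= e)%N) ->
  pending_sum m E = motzkin gamma beta m #|E|.
Proof.
elim: m E => [|m IHm] E le_mN geE.
  rewrite /pending_sum /=.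
  transitivity (\sum_(f : {ffun 'I_N -> option 'I_N} |
                   (f == [ffun=> None]) && (E == set0)) (1 : R)).
    apply: eq_big => [f|f _]; last by rewrite big_pred0.
    apply/pendingP/andP => [[H1 _ H3]|[/eqP-> /eqP->]].
      have fN i : f i = None.
        by case fi: (f i) => [j|] //; case/and3P: (H1 _ _ fi).
      split; first by apply/eqP/ffunP => i; rewrite ffunE.
      by rewrite -subset0; apply/subsetP => e /H3[i]; rewrite fN.
    by split=> [i j|i i' j|e]; rewrite ?ffunE ?inE.
  rewrite cards_eq0; case: (E == set0); last first.
    by rewrite big_pred0 // => f; rewrite andbF.
  by under eq_bigl do rewrite andbT; rewrite big_pred1_eq.
pose p : 'I_N := Ordinal le_mN.
rewrite (@pending_sum_rec p) //.
have IH F : F \subset p |: E -> pending_sum p F = motzkin gamma beta m #|F|.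
  move=> /subsetP sF; apply: IHm (ltnW le_mN) _ => e /sF/setU1P[->//|/geE].
  exact: ltnW.
have pNE F : F \subset E -> p \notin F.
  by move=> /subsetP sF; apply/negP => /sF/geE; rewrite ltnn.
rewrite (bigD1 None) //= IH ?subsetUr // IH // cardsU1 pNE // mul1r.
rewrite (reindex_omap Some id) => [|[]//] /=.
have sumE : \sum_(e in E) (top_weight E (Some e) false * pending_sum p (E :\ e)
        + top_weight E (Some e) true * pending_sum p (p |: E :\ e))
  = (if #|E| is k.+1 then beta k.+1 * motzkin gamma beta m k
       + (y1 + k%:R * v1) * motzkin gamma beta m k.+1 else 0).
  case: (set_0Vmem E) => [->|[e0 e0E]]; first by rewrite big_set0 cards0.
  have [k cE] : exists k, #|E| = k.+1.
    by exists #|E|.-1; rewrite prednK // (cardD1 e0) e0E.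
  have cD e : e \in E -> #|E :\ e| = k.
    by move=> eE; move: cE; rewrite (cardsD1 e) eE => -[].
  have sumk (a b : R) : \sum_(e in E) (if [forall e' in E, e' <= e]%N then a else b)
      = a + k%:R * b by rewrite (sum_largest _ _ e0E) cE subn1.
  rewrite cE /beta subn1 /= -!sumk mulr_sumr !mulr_suml -big_split /=.
  apply: eq_bigr => e eE; rewrite !IH ?subD1set ?setUS ?subD1set //.
    by rewrite cD // cardsU1 pNE ?subD1set // cD.
  exact: subset_trans (subD1set _ _) (subsetUr _ _).
under eq_bigl => e do rewrite eqxx !andbT.
rewrite [\sum_(e in E) _]sumE /gamma; case: #|E| => [|k] /=; first by ring.
by rewrite subn1 /=; ring.
Qed.

End ArcSums.

(** * Set partitions as arc diagrams *)

Section Blocks.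
Variable n : nat.
Implicit Types (P : {set {set 'I_n}}) (f : {ffun 'I_n -> option 'I_n}).
Implicit Types (i j k : 'I_n).

(** The successor of an element in its block, as an arc. *)
Definition next_in_block P : {ffun 'I_n -> option 'I_n} :=
  [ffun i => [pick j in pblock P i | (i < j)%N &
        [forall k in pblock P i, (i < k) ==> (j <= k)]%N]].

Lemma sigma'E P i : sigma' P i = if next_in_block P i is Some j then j.+1 else 0%N.
Proof. by rewrite ffunE. Qed.

Lemma next_some P i j : next_in_block P i = Some j ->
  [/\ j \in pblock P i, (i < j)%N
    & forall k, k \in pblock P i -> (i < k)%N -> (j <= k)%N].
Proof.
rewrite ffunE; case: pickP => // j' /and3P[jP lt_ij /forall_inP min] [<-].
by split=> // k /min/implyP.
Qed.

Lemma next_isSome P i : next_in_block P i = ~~ largest_in_block P i :> bool.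
Proof.
rewrite ffunE /largest_in_block negb_forall_in.
apply/idP/exists_inP => [|[j jP]].
  case: pickP => // j /and3P[jP lt_ij _] _; exists j => //.
  by rewrite -ltnNge.
rewrite -ltnNge => lt_ij; case: pickP => // none.
pose Q := [pred k | (k \in pblock P i) && (i < k)%N].
have Qj : Q j by rewrite /= jP.
have [k /andP[kP lt_ik] min] := arg_minnP (fun k => nat_of_ord k) Qj.
have /negP[] := none k; rewrite /= kP lt_ik /=.
by apply/forall_inP => l lP; apply/implyP => lt_il; apply: min; rewrite /= lP.
Qed.

Section NextOfPartition.
Variables (P : {set {set 'I_n}}) (partP : partition P [set: 'I_n]).

Let mem_pblockT i : i \in pblock P i.
Proof. by rewrite mem_pblock (cover_partition partP) inE. Qed.

Let pblock_eq i j : (j \in pblock P i) = (pblock P i == pblock P j).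
Proof. by rewrite eq_pblock ?(partition_trivIset partP) ?(cover_partition partP) ?inE. Qed.

Lemma pending_next : pending n set0 (next_in_block P).
Proof.
apply/pendingP; split=> [i j /next_some[_ -> _]|i i' j|e]; rewrite ?inE //.
  by rewrite !ltn_ord.
wlog lt_ii' : i i' / (i < i')%N => [wlogH nx nx'|].
  have [/wlogH->//|/wlogH|] := ltngtP i i'; last exact: val_inj.
  by move=> <-.
move=> /next_some[jP lt_ij min] /next_some[jP' lt_i'j _].
have /min/(_ lt_ii') : i' \in pblock P i.
  by move: jP jP'; rewrite !pblock_eq => /eqP-> /eqP->.
by rewrite leqNgt lt_i'j.
Qed.

Lemma receives_next i : receives (next_in_block P) i = ~~ smallest_in_block P i.
Proof.
rewrite /smallest_in_block negb_forall_in; apply/existsP/exists_inP => -[j].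
  case/andP=> lt_ji /eqP/next_some[iP _ _]; exists j; last by rewrite -ltnNge.
  by move: iP; rewrite !pblock_eq eq_sym.
rewrite -ltnNge => jP lt_ji.
pose Q := [pred k | (k \in pblock P i) && (k < i)%N].
have Qj : Q j by rewrite /= jP.
have [k /andP[kP lt_ki] max] := arg_maxnP (fun k => nat_of_ord k) Qj.
have eqB : pblock P k = pblock P i by move: kP; rewrite pblock_eq => /eqP.
exists k; rewrite lt_ki /=.
have : ~~ largest_in_block P k.
  rewrite /largest_in_block negb_forall_in; apply/exists_inP; exists i.
    by rewrite eqB.
  by rewrite -ltnNge.
rewrite -next_isSome; case nk: (next_in_block P k) => [l|] // _; apply/eqP; congr Some.
have [lP lt_kl min] := next_some nk.
apply/val_inj/eqP; rewrite eqn_leq min ?eqB // leqNgt; apply/negP => lt_li.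
have /max : Q l by rewrite /= -eqB lP.
by rewrite /= leqNgt lt_kl.
Qed.

Let s := smallest_in_block P.
Let l := largest_in_block P.

Lemma card_block2 i : (2 <= #|pblock P i|)%N = ~~ (s i && l i).
Proof.
rewrite leqNgt ltnS (cardD1 i) mem_pblockT add1n ltnS leqn0; congr (~~ _).
apply/eqP/andP => [/card0_eq B0|[/forall_inP si /forall_inP li]].
  by split; apply/forall_inP => j jP; have := B0 j; rewrite !inE jP andbT;
    move/negbFE/eqP->.
apply/eqP; rewrite -leqn0 leqNgt; apply/negP => /card_gt0P[j].
rewrite !inE => /andP[ne jP]; case/eqP: ne; apply/val_inj/eqP.
by rewrite eqn_leq si ?li.
Qed.

Lemma card_block3 i : ~~ s i -> ~~ l i -> (3 <= #|pblock P i|)%N.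
Proof.
rewrite !negb_forall_in => /exists_inP[j jP]; rewrite -ltnNge => lt_ji.
move=> /exists_inP[k kP]; rewrite -ltnNge => lt_ik.
rewrite (cardD1 i) mem_pblockT (cardD1 j) (cardD1 k) !inE jP kP.
have lt_jk := ltn_trans lt_ji lt_ik.
have ne (a b : 'I_n) : (a < b)%N -> a != b by case: eqP => // ->; rewrite ltnn.
by rewrite (ne _ _ lt_ji) [k == i]eq_sym [k == j]eq_sym (ne _ _ lt_ik) (ne _ _ lt_jk).
Qed.

Lemma singletonE i : singleton P i = s i && l i.
Proof.
rewrite -[RHS]negbK -card_block2 -ltnNge ltnS /singleton eqn_leq andbC.
suff -> : (0 < #|pblock P i|)%N by [].
by apply/card_gt0P; exists i.
Qed.

Lemma openerE i : opener P i = s i && ~~ l i.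
Proof. by rewrite /opener card_block2 -/(s i); case: (s i); case: (l i). Qed.

Lemma insiderE i : insider P i = ~~ s i && ~~ l i.
Proof.
rewrite /insider /closer openerE card_block2 -/(l i).
have B2 : (3 <= #|pblock P i|)%N -> ~~ (s i && l i).
  by rewrite -card_block2; apply: ltnW.
move: B2 (@card_block3 i); case: (s i); case: (l i) => B2 B3 /=; rewrite ?andbF //.
  by apply/negP => /andP[/B2].
by rewrite B3.
Qed.

Lemma erecE i :
  erec P i = if next_in_block P i is Some e then arc_record (next_in_block P) i e else false.
Proof.
rewrite /erec !sigma'E; case: (next_in_block P i) => [e|] //=.
by apply: eq_forallb => j; rewrite sigma'E; case: (next_in_block P j).
Qed.

(** A block of size at least 2 has exactly one opener, its smallest element. *)
Lemma m_ge2E : m_ge2 P = #|[set i | opener P i]|.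
Proof.
rewrite /m_ge2; have <- : pblock P @: [set i | opener P i] = [set A in P | 2 <= #|A|]%N.
  apply/setP => A; rewrite inE; apply/imsetP/andP => [[i]|[AP A2]].
    rewrite inE => /andP[B2 _] ->; rewrite B2; split=> //.
    by rewrite pblock_mem ?(cover_partition partP) ?inE.
  have /card_gt0P[i0 i0A] : (0 < #|A|)%N by apply: leq_trans A2.
  have [i iA min] := arg_minnP (fun k => nat_of_ord k) i0A.
  have BA := def_pblock (partition_trivIset partP) AP iA.
  exists i => //; rewrite inE /opener BA A2; apply/forall_inP => j.
  by rewrite BA; apply: min.
apply: card_in_imset => i j; rewrite !inE => /andP[_ /forall_inP si].
case/andP=> _ /forall_inP sj eqB; apply/val_inj/eqP.
by rewrite eqn_leq si ?sj ?eqB // -eqB.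
Qed.

End NextOfPartition.

(** Stops at the end of a chain of arcs, so that iterating it often enough
    ([n] times) yields the last element of the chain. *)
Definition follow f i := odflt i (f i).

Definition lead f i := iter n (follow f) i.

(** Two elements share a block if their chains of arcs end at the same
    element. *)
Definition blocks f := preim_partition (lead f) [set: 'I_n].

Section BlocksOfArcs.
Variables (f : {ffun 'I_n -> option 'I_n}) (arcs_f : pending n set0 f).

Let f_lt i j : f i = Some j -> (i < j)%N.
Proof. by case/pendingP: arcs_f => H _ _ /H/and3P[]. Qed.

Let f_inj i i' j : f i = Some j -> f i' = Some j -> i = i'.
Proof. by case/pendingP: arcs_f => _ H _; apply: H. Qed.

(** Each step that has not stopped increases the element, so a chain of [n]
    steps in ['I_n] must have stopped. *)
Lemma lead_none i : f (lead f i) = None.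
Proof.
have ge m : f (iter m (follow f) i) -> (m <= iter m (follow f) i)%N.
  elim: m => //= m IHm; rewrite {1 3}/follow.
  case fm: (f _) IHm => [j|] /=; last by rewrite fm.
  by move=> /(_ isT) le_m _; apply: leq_ltn_trans le_m (f_lt fm).
have := ge n; rewrite -/(lead f i); case: (f _) => // j /(_ isT).
by rewrite leqNgt ltn_ord.
Qed.

Lemma lead_arc i j : f i = Some j -> lead f j = lead f i.
Proof.
move=> fi; have -> : j = follow f i by rewrite /follow fi.
by rewrite /lead -iterSr iterS -/(lead f i) /follow lead_none.
Qed.

Lemma lead_last i : f i = None -> lead f i = i.
Proof.
move=> fi; rewrite /lead; elim: (n in iter n) => //= m ->.
by rewrite /follow fi.
Qed.

Lemma lead_ge i : (i <= lead f i)%N.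
Proof.
rewrite /lead; elim: (n in iter n) => //= m /leq_trans-> //.
by rewrite {2}/follow; case fm: (f _) => [j|] //=; apply/ltnW/f_lt.
Qed.

(** If the arc of [i] jumped over an element [k] of the same chain, the arcs from
    [k] would stay below its target [j]: they cannot jump over [j], by
    induction, nor hit it, by injectivity.  This cannot go on forever, but it
    also cannot stop, since the chain of [k] ends at or above [j]. *)
Lemma arc_adjacent i k : lead f i = lead f k -> (i < k)%N ->
  exists2 j, f i = Some j & (j <= k)%N.
Proof.
have [m] := ubnP (n - i); elim: m i k => // m IHm i k lt_m eq_ik lt_ik.
case fi: (f i) => [j|]; last first.
  by have := lead_ge k; rewrite -eq_ik lead_last // leqNgt lt_ik.
exists j => //; rewrite leqNgt; apply/negP.
have {eq_ik}: lead f k = lead f j by rewrite (lead_arc fi).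
have [d] := ubnP (n - k); elim: d k lt_ik => // d IHd k lt_ik lt_d eq_kj lt_kj.
have lt_km : (n - k < m)%N.
  by rewrite -ltnS (leq_trans _ lt_m) // ltnS ltn_sub2l // (leq_trans lt_ik) // ltnW.
have [l fk] := IHm k j lt_km eq_kj lt_kj.
rewrite leq_eqVlt => /orP[/eqP/val_inj lj|lt_lj].
  by rewrite (f_inj fi (_ : f k = Some j)) ?ltnn // -lj in lt_ik.
have lt_kl := f_lt fk.
apply: (IHd l) => //; first exact: ltn_trans lt_kl.
  by rewrite -ltnS (leq_trans _ lt_d) // ltnS ltn_sub2l // ltnW.
by rewrite (lead_arc fk).
Qed.

Lemma mem_blocks i k : (k \in pblock (blocks f) i) = (lead f i == lead f k).
Proof.
rewrite pblock_equivalence_partition ?inE // => x y z _ _ _ /=.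
by split=> // /eqP->.
Qed.

Lemma next_blocks : next_in_block (blocks f) = f.
Proof.
apply/ffunP => i; case nx: (next_in_block (blocks f) i) => [j|].
  have [] := next_some nx; rewrite mem_blocks => /eqP eq_ij lt_ij min.
  have [k fi le_kj] := arc_adjacent eq_ij lt_ij.
  rewrite fi; congr Some; apply/val_inj/eqP; rewrite eqn_leq le_kj andbT min //.
    by rewrite mem_blocks (lead_arc fi).
  exact: f_lt.
case fi: (f i) => [j|] //; have := next_isSome (blocks f) i.
rewrite nx => /esym/negbFE/forall_inP/(_ j).
by rewrite mem_blocks (lead_arc fi) eqxx leqNgt f_lt // => /(_ isT).
Qed.

End BlocksOfArcs.

Lemma blocks_partition f : partition (blocks f) [set: 'I_n].
Proof. exact: preim_partitionP. Qed.

(** The chain of arcs from [i] ends at the largest element of the block of [i],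
    which determines the block. *)
Lemma blocks_next P : partition P [set: 'I_n] -> blocks (next_in_block P) = P.
Proof.
move=> partP; have arcs := pending_next partP.
have pblock_eq i j : (j \in pblock P i) = (pblock P i == pblock P j).
  by rewrite eq_pblock ?(partition_trivIset partP) ?(cover_partition partP) ?inE.
have leadP i : lead (next_in_block P) i \in pblock P i.
  rewrite pblock_eq eq_sym /lead; elim: (n in iter n) => //= m /eqP <-.
  rewrite {1}/follow; case nx: (next_in_block P _) => [j|] //=.
  by have [] := next_some nx; rewrite pblock_eq eq_sym.
have lead_largest i k : k \in pblock P i -> (k <= lead (next_in_block P) i)%N.
  move=> kP; have := next_isSome P (lead (next_in_block P) i); rewrite lead_none //.
  move=> /esym/negbFE/forall_inP; apply.
  by move: (leadP i) kP; rewrite !pblock_eq => /eqP <-.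
rewrite -[RHS](preim_partition_pblock partP).
apply: eq_imset => i; apply/setP => j; rewrite !inE /=.
apply/eqP/eqP => [eq_ij|eqB].
  have := leadP j; rewrite -eq_ij; have := leadP i; rewrite !pblock_eq.
  by move=> /eqP-> /eqP->.
by apply/val_inj/eqP; rewrite eqn_leq !lead_largest // -?eqB // eqB.
Qed.

End Blocks.

(** * Partition statistics as a product of local weights *)

Section Weights.
Variables (R : comNzRingType) (x1 x2 y1 y2 v1 v2 : R).

Lemma expr_card_set (T : finType) (Q : pred T) (x : R) :
  x ^+ #|[set i | Q i]| = \prod_i (if Q i then x else 1).
Proof.
by rewrite -prodr_const big_mkcond /=; apply: eq_bigr => i _; rewrite inE.
Qed.

Lemma partition_weight n (P : {set {set 'I_n}}) : partition P [set: 'I_n] ->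
  x1 ^+ m1 P * x2 ^+ m_ge2 P * y1 ^+ erecin P * y2 ^+ erecop P
    * v1 ^+ nerecin P * v2 ^+ nerecop P
  = \prod_i arc_weight x1 x2 y1 y2 v1 v2 (next_in_block P) i.
Proof.
move=> partP; rewrite (m_ge2E partP) !expr_card_set -!big_split /=.
apply: eq_bigr => i _; rewrite /arc_weight.
rewrite singletonE // openerE // insiderE // erecE receives_next //.
have := next_isSome P i.
case: (next_in_block P i) => [e|] /= /esym; [move/negPf->|move/negbFE->];
  case: (smallest_in_block P i); rewrite ?andbF ?andbT /=;
  try case: (arc_record _ _ _); by rewrite ?(mulr1, mul1r).
Qed.

Lemma B_motzkin n :
  B x1 x2 y1 y2 v1 v2 n = motzkin (gamma x1 y1 v1) (beta x2 y2 v2) n 0%N.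
Proof.
rewrite -(cards0 'I_n) -pending_sum_motzkin //; last by move=> e; rewrite inE.
rewrite /B (reindex_onto (@blocks n) (@next_in_block n)) => [|P]; last exact: blocks_next.
apply: eq_big => [f|f /andP[partP /eqP nf]].
  apply/andP/idP => [[partP /eqP <-]|arcs]; first exact: pending_next.
  by rewrite blocks_partition next_blocks.
by rewrite partition_weight // nf; apply: eq_bigl => i; rewrite ltn_ord.
Qed.

End Weights.

Theorem theorem3p2 :
  let x1 : {mpoly int[6]} := 'X_(inord 0) in
  let x2 : {mpoly int[6]} := 'X_(inord 1) in
  let y1 : {mpoly int[6]} := 'X_(inord 2) in
  let y2 : {mpoly int[6]} := 'X_(inord 3) in
  let v1 : {mpoly int[6]} := 'X_(inord 4) in
  let v2 : {mpoly int[6]} := 'X_(inord 5) in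
  let gamma (n : nat) := if n == 0%N then x1 else x1 + y1 + (n - 1)%:R * v1 in
  let beta (n : nat) := x2 * (y2 + (n - 1)%:R * v2) in
  is_jfrac gamma beta (B x1 x2 y1 y2 v1 v2).
Proof.
move=> x1 x2 y1 y2 v1 v2 g b n.
by rewrite B_motzkin; apply: is_jfrac_motzkin.
Qed.
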